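(* Let $A>0$, $\sigma>0$. There are $c>0$, $\lambda_0\geq 0$, $n_0\geq 1$ such that for any $n\geq n_0$ and any independent sequence $X_1,\dots,X_n$ of real random variables with $$E(X_i)=0,\quad E(|X_i|^3)\leq A,\quad E(X_i^2)\geq\sigma^2,\qquad i=1,\dots,n,$$ the following holds. For any $\lambda$ with $\sqrt{n}\geq\lambda\geq\lambda_0$, $$P_0\bigl(\max_{i=1,\dots,n}|S_i|\leq\lambda\bigr)\leq\exp\Bigl(-\frac{cn}{\lambda^2}\Bigr).$$
   Context: Under $P_0$ the walk is $S_0=0$, $S_k=X_1+\dots+X_k$. *)

(* Defs.v *)
From HB Require Import structures.
From mathcomp Require Import all_boot all_order all_algebra.
From mathcomp Require Import all_classical all_reals all_analysis.

Set Implicit Arguments.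
Unset Strict Implicit.
Unset Printing Implicit Defensive.

Import Order.TTheory GRing.Theory Num.Theory.

Local Open Scope classical_set_scope.
Local Open Scope ring_scope.

(* Mutual (not merely pairwise) independence: the product rule for every
   subfamily J and every choice of Borel sets. *)
Definition mutually_independent (R : realType) (d : measure_display)
    (T : measurableType d) (P : probability T R) (I : finType)
    (X : I -> {RV P >-> R}) : Prop :=
  forall (J : {set I}) (B : I -> set R),
    (forall i, i \in J -> measurable (B i)) ->
    P [set w | forall i, i \in J -> B i (X i w)] =
      (\prod_(i in J) P (X i @^-1` B i))%E.

(* The steps are indexed from 0, so the sum of the first k steps, started at 0,
   involves the indices i < k. *)
Definition walk (R : realType) (d : measure_display)
    (T : measurableType d) (P : probability T R) (n : nat)
    (X : 'I_n -> {RV P >-> R}) (k : nat) (w : T) : R :=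
  \sum_(i < n | (i < k)%N) X i w.

(* The seed 0 of the maximum is harmless when 1 <= n, as the entries are
   nonnegative. *)
Definition max_abs_walk (R : realType) (d : measure_display)
    (T : measurableType d) (P : probability T R) (n : nat)
    (X : 'I_n -> {RV P >-> R}) (w : T) : R :=
  \big[Num.max/0]_(1 <= k < n.+1) `|walk X k w|.

(* Main.v *)
Require Import Defs.
From HB Require Import structures.
From mathcomp Require Import all_boot all_order all_algebra.
From mathcomp Require Import all_classical all_reals all_analysis.
From mathcomp Require Import measurable_realfun ring lra.

Set Implicit Arguments.
Unset Strict Implicit.
Unset Printing Implicit Defensive.

Import Order.TTheory GRing.Theory Num.Theory.

Local Open Scope classical_set_scope.
Local Open Scope ring_scope.

(** The proof compares the walk with the test function
      f(s) = exp(b min(s / lambda, 2)),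
    an exponential frozen at distance 2 lambda so that it is bounded by
    exp(2b).  Its exponent b is a large constant depending on sigma only.

    Taylor expansion of f, with a cubic remainder that also absorbs the effect
    of the cap, shows that a centred step X with second moment at least
    sigma^2 and third absolute moment at most A satisfies
      E f(s + X) >= r f(s),   r = 1 + kappa / lambda^2,
      kappa = b^2 sigma^2 / 8,
    for every |s| <= lambda as soon as lambda is large (capped_exp_drift).
    Let p_k be the probability that the walk has stayed in [-lambda, lambda]
    up to time k, and D_k the integral of f(S_k) over that event.  Since a
    walk that leaves at time k + 1 contributes at most exp(2b), the drift gives
      r D_k <= D_(k+1) + exp(2b) (p_k - p_(k+1)),
    while exp(-b) p_k <= D_k <= exp(b) p_k (survival_recursion).

    Over a block of m = floor(lambda^2) steps the growth factor r^m is at least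
    exp(kappa / 4).  The choice b = 128 / sigma^2 makes this exp(4b), because
    kappa is quadratic in b while log f varies only linearly in b.  A walk
    that stayed inside could not support such a growth of D, so a fixed
    proportion delta of the mass must leave during each block:
    p_(k+m) <= (1 - delta) p_k (block_contraction).  As lambda^2 <= n, there
    are at least n / (2 lambda^2) complete blocks in n steps, which is the
    claim with c = delta / 2.  The growth argument produces a positive exit
    probability within a block however small sigma is, so no central limit
    theorem is involved.

    The probabilistic input is that the position at time k, together with the
    information that the walk has not left yet, is independent of the next
    step.  Both are encoded in one real number, the walk stopped when it leaves
    [-lambda, lambda]; its independence from the later steps is proved by
    induction on time (stopped_walk_indep_cylinder), and Tonelli's theorem then
    turns the pointwise drift into a drift of the integrals
    (independent_drift). *)

(** * Independence and drift *)

(** Measurable rectangles form a pi-system generating the product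
    sigma-algebra, so two finite measures that agree on them agree everywhere:
    here the law of (U, V) restricted to D, and the law of (U, V) scaled by
    P D. *)
Lemma rectangle_independence_ext (R : realType) (d d1 d2 : measure_display)
    (T : measurableType d) (T1 : measurableType d1) (T2 : measurableType d2)
    (P : probability T R) (U : {mfun T >-> T1}) (V : {mfun T >-> T2})
    (D : set T) : measurable D ->
  (forall A B, measurable A -> measurable B ->
     P ((U @^-1` A `&` V @^-1` B) `&` D) =
       (P (U @^-1` A `&` V @^-1` B) * P D)%E) ->
  forall C : set (T1 * T2), measurable C ->
    P ([set w | C (U w, V w)] `&` D) = (P [set w | C (U w, V w)] * P D)%E.
Proof.
move=> mD rectD C mC.
have mUV : measurable_fun [set: T] (fun w => (U w, V w)).
  exact: measurable_fun_pair.
pose UV : {mfun T >-> (T1 * T2)%type} :=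
  HB.pack (fun w => (U w, V w)) (isMeasurableFun.Build _ _ _ _ _ mUV).
pose m1 : {measure set (T1 * T2) -> \bar R} := pushforward (mrestr P mD) UV.
have PD0 : 0 <= fine (P D) by exact: fine_ge0.
pose m2 : {measure set (T1 * T2) -> \bar R} :=
  mscale (NngNum PD0) (distribution P UV).
pose G : set (set (T1 * T2)) :=
  [set A `*` B | A in measurable & B in measurable].
suff mC12 : m1 mUV C = m2 C.
  by rewrite muleC -[P D in RHS]fineK ?fin_num_measure//; exact: mC12.
apply: (measure_unique G (fun=> setT) _ _ _ _ (m1 mUV) m2) => //.
- exact: measurable_prod_measurableType.
- move=> _ _ [A1 mA1 [B1 mB1 <-]] [A2 mA2 [B2 mB2 <-]].
  rewrite -setXI; exists (A1 `&` A2); first exact: measurableI.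
  by exists (B1 `&` B2); first exact: measurableI.
- move=> _; exists setT => //; exists setT => //.
  by rewrite setXTT.
- by rewrite bigcup_const//; exists 0%N.
- move=> _ [A mA [B mB <-]].
  have := rectD _ _ mA mB.
  by rewrite muleC -[P D in RHS]fineK ?fin_num_measure.
- by move=> _; rewrite ltey_eq fin_num_measure// preimage_setT.
Qed.

(** Independence says that the law of (U, V) is the product of the laws of U
    and V, since the two agree on rectangles. *)
Lemma independent_tonelli (R : realType) (d d1 d2 : measure_display)
    (T : measurableType d) (T1 : measurableType d1) (T2 : measurableType d2)
    (P : probability T R) (U : {mfun T >-> T1}) (V : {mfun T >-> T2})
    (g : T1 * T2 -> \bar R) :
  (forall A B, measurable A -> measurable B ->
     P (U @^-1` A `&` V @^-1` B) = (P (U @^-1` A) * P (V @^-1` B))%E) ->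
  measurable_fun [set: T1 * T2] g -> (forall z, (0 <= g z)%E) ->
  (\int[P]_w g (U w, V w) = \int[P]_w \int[P]_w' g (U w, V w'))%E.
Proof.
move=> indep mg g0.
have mUV : measurable_fun [set: T] (fun w => (U w, V w)).
  exact: measurable_fun_pair.
pose UV : {mfun T >-> (T1 * T2)%type} :=
  HB.pack (fun w => (U w, V w)) (isMeasurableFun.Build _ _ _ _ _ mUV).
pose PU := distribution P U. pose PV := distribution P V.
transitivity (\int[PU \x PV]_z g z)%E.
  rewrite (eq_measure_integral (distribution P UV)); last first.
    move=> C mC _; apply: product_measure_unique mC => A B mA mB.
    by rewrite /distribution /pushforward/= -indep.
  by rewrite ge0_integral_distribution.
rewrite fubini_tonelli1// ge0_integral_distribution//; last 2 first.
- exact: measurable_fun_fubini_tonelli_F.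
- by move=> x; apply: integral_ge0.
apply: eq_integral => w _; rewrite /= /fubini_F ge0_integral_distribution//.
exact: measurableT_comp.
Qed.

(** Freezing U at a value x in S and averaging over V only multiplies f by
    at least r; independence allows this freezing by Tonelli's theorem. *)
Lemma independent_drift (R : realType) (d : measure_display)
    (T : measurableType d) (P : probability T R) (U V : {RV P >-> R})
    (S : set R) (f : R -> R) (r : R) :
  measurable S -> measurable_fun [set: R] f -> (forall x, 0 <= f x) ->
  0 <= r ->
  (forall A B, measurable A -> measurable B ->
     P (U @^-1` A `&` V @^-1` B) = (P (U @^-1` A) * P (V @^-1` B))%E) ->
  (forall x, S x -> ((r * f x)%:E <= \int[P]_w (f (x + V w))%:E)%E) ->
  (r%:E * \int[P]_(w in U @^-1` S) (f (U w))%:E <=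
     \int[P]_(w in U @^-1` S) (f (U w + V w))%:E)%E.
Proof.
move=> mS mf f0 r0 indep drift.
have mUS : measurable (U @^-1` S).
  by rewrite -[_ @^-1` _]setTI; exact: measurable_funP.
pose g (z : R * R) : \bar R := (\1_S z.1 * f (z.1 + z.2))%:E.
have mg : measurable_fun [set: R * R] g.
  apply/measurable_EFinP; apply: measurable_funM.
    exact: (measurableT_comp (measurable_indic mS)).
  by apply: (measurableT_comp mf); exact: measurable_funD.
have g0 z : (0 <= g z)%E by rewrite lee_fin mulr_ge0.
have restrE (h : T -> \bar R) w :
    (h \_ (U @^-1` S)) w = ((\1_S (U w))%:E * h w)%E.
  rewrite patchE indicE.
  have -> : (w \in U @^-1` S) = (U w \in S) by apply/idP/idP; rewrite !inE.
  by case: ifP; rewrite ?mul1e ?mul0e.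
have -> : (\int[P]_(w in U @^-1` S) (f (U w + V w))%:E =
    \int[P]_w g (U w, V w))%E.
  rewrite integral_mkcond; apply: eq_integral => w _.
  by rewrite restrE /g EFinM.
rewrite (independent_tonelli indep mg g0).
rewrite -ge0_integralZl//; last 2 first.
- exact/measurable_EFinP/measurable_funTS/measurableT_comp.
- by move=> x _; rewrite lee_fin.
rewrite integral_mkcond; apply: ge0_le_integral => //.
- by move=> w _; rewrite restrE mule_ge0// lee_fin ?mulr_ge0.
- apply/measurable_restrict => //; rewrite setTI.
  apply/measurable_EFinP/measurable_funTS/measurable_funM => //.
  exact: measurableT_comp.
- have mF : measurable_fun [set: R] (fubini_F (distribution P V) g).
    exact: measurable_fun_fubini_tonelli_F.
  apply: eq_measurable_fun (measurableT_comp mF (measurable_funP U)) => w _.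
  rewrite /= /fubini_F ge0_integral_distribution//.
  exact: measurableT_comp.
move=> w _; rewrite restrE /g/= indicE.
case: (boolP (U w \in S)) => [|_].
  rewrite inE mul1e => Sx; under eq_integral do rewrite mul1r.
  exact: drift.
rewrite mul0e; apply: integral_ge0 => w' _.
by rewrite mul0r.
Qed.

(** * The drift of the capped exponential *)

Lemma expR_ge_quadratic (R : realType) (t : R) :
  -2 <= t -> 1 + t + t ^+ 2 / 4 <= expR t.
Proof.
move=> t_ge.
have -> : 1 + t + t ^+ 2 / 4 = (1 + t / 2) ^+ 2 by field.
have -> : expR t = expR (t / 2) ^+ 2.
  by rewrite -expRM_natl; congr expR; field.
rewrite ler_pXn2r ?nnegrE ?expR_ge0 ?expR_ge1Dx//; lra.
Qed.

(** The coefficient 1/4 instead of the optimal 1/2 makes the expansion the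
    square of exp(t/2) >= 1 + t/2, which covers t >= -2; for t < -2 the cubic
    term makes the left side negative. *)
Lemma expR_ge_taylor (R : realType) (t : R) :
  1 + t + t ^+ 2 / 4 - `|t| ^+ 3 <= expR t.
Proof.
have [t_ge|t_lt] := leP (-2) t.
  apply: le_trans (expR_ge_quadratic t_ge).
  by rewrite gerBl exprn_ge0.
rewrite ltr0_norm; last lra.
apply: le_trans (expR_ge0 _).
have : 0 <= (- t) * (- t) by rewrite -expr2 sqr_ge0.
nra.
Qed.

(** For z <= 1 the cap is not reached and this is the Taylor bound.  For
    z > 1 the capped exponential is at least its value at y, and the cubic term
    dominates the linear and the quadratic one. *)
Lemma capped_expR_ge (R : realType) (b y z : R) : 0 <= b -> y <= 1 ->
  expR (b * y) * (1 + b * z + (b * z) ^+ 2 / 4 - (1 + b) ^+ 3 * `|z| ^+ 3)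
    <= expR (b * Num.min (y + z) 2).
Proof.
move=> b_ge0 y_le1.
have [z_le1|z_gt1] := leP z 1.
  have -> : Num.min (y + z) 2 = y + z by rewrite min_l //; lra.
  rewrite [b * (y + z)]mulrDr expRD ler_pM2l ?expR_gt0//.
  apply: le_trans (expR_ge_taylor _).
  rewrite lerD2l lerN2 normrM exprMn ler_wpM2r ?exprn_ge0//.
  rewrite (ger0_norm b_ge0) ler_pXn2r ?nnegrE//; lra.
apply: (@le_trans _ _ (expR (b * y))).
  rewrite ler_piMr ?expR_ge0// gtr0_norm; last lra.
  have z3 : z <= z ^+ 3 by rewrite ler_eXnr//; lra.
  have z2 : z ^+ 2 <= z ^+ 3 by rewrite ler_weXn2l//; lra.
  have e1 : b * z <= b * z ^+ 3 by rewrite ler_wpM2l.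
  have e2 : b ^+ 2 * z ^+ 2 <= b ^+ 2 * z ^+ 3 by rewrite ler_wpM2l ?sqr_ge0.
  have e3 : (b + b ^+ 2 / 4) * z ^+ 3 <= (1 + b) ^+ 3 * z ^+ 3.
    rewrite ler_wpM2r ?exprn_ge0//; first lra.
    have : 0 <= b ^+ 2 by apply: sqr_ge0.
    have : 0 <= b ^+ 3 by apply: exprn_ge0.
    by rewrite !exprS expr0; lra.
  have := sqr_ge0 (b * z).
  rewrite exprMn; lra.
rewrite ler_expR ler_wpM2l// le_min; apply/andP; split; lra.
Qed.

(** Applied to y = |X|, this bounds the lower moments by the n-th one. *)
Lemma exprn_le1D (R : realType) (y : R) (k n : nat) :
  0 <= y -> (k <= n)%N -> y ^+ k <= 1 + y ^+ n.
Proof.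
move=> y0 kn; have [y1|y1] := leP y 1.
  by rewrite (le_trans (exprn_ile1 k y0 y1))// lerDl exprn_ge0.
by rewrite (le_trans (ler_weXn2l (ltW y1) kn))// lerDr.
Qed.

Lemma integrable_abs3 (R : realType) (d : measure_display)
    (T : measurableType d) (P : probability T R) (X : {RV P >-> R}) :
  ('E_P[fun w => (`|X w| ^+ 3)%R] < +oo)%E ->
  [/\ P.-integrable setT (EFin \o X),
      P.-integrable setT (EFin \o (fun w => X w ^+ 2)) &
      P.-integrable setT (EFin \o (fun w => `|X w| ^+ 3))].
Proof.
rewrite unlock => X3oo.
have i3 : P.-integrable setT (EFin \o (fun w => `|X w| ^+ 3)).
  apply/integrableP; split.
    apply/measurable_EFinP; apply: measurable_funX; exact: measurableT_comp.
  by under eq_integral do rewrite /= ger0_norm ?exprn_ge0//.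
have i1 : P.-integrable setT (EFin \o cst (1 : R)).
  exact: finite_measure_integrable_cst.
have dom (h : T -> R) : measurable_fun setT h ->
    (forall w, `|h w| <= 1 + `|X w| ^+ 3) -> P.-integrable setT (EFin \o h).
  move=> mh hle; apply: (le_integrable _ _ _ (integrableD _ i1 i3)) => //.
    exact/measurable_EFinP.
  move=> w _ /=; rewrite lee_fin (le_trans (hle w))// ler_norm//.
have iX : P.-integrable setT (EFin \o X).
  apply: dom => // w; by rewrite -[X in X <= _]expr1 exprn_le1D.
split => //.
  apply: dom => [|w]; first by apply: measurable_funX; exact: measurable_funP.
  by rewrite normrX exprn_le1D.
Qed.

Lemma integral_cubic (R : realType) (d : measure_display)
    (T : measurableType d) (P : probability T R) (X : {RV P >-> R})
    (c0 c1 c2 c3 : R) :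
  ('E_P[fun w => (`|X w| ^+ 3)%R] < +oo)%E ->
  P.-integrable setT
    (fun w => (c0 + c1 * X w + c2 * X w ^+ 2 + c3 * `|X w| ^+ 3)%:E) /\
  (\int[P]_w (c0 + c1 * X w + c2 * X w ^+ 2 + c3 * `|X w| ^+ 3)%:E =
   c0%:E + c1%:E * 'E_P[X] + c2%:E * 'E_P[fun w => (X w ^+ 2)%R] +
   c3%:E * 'E_P[fun w => (`|X w| ^+ 3)%R])%E.
Proof.
move=> /integrable_abs3[i1 i2 i3]; rewrite expectation.unlock.
have i0 : P.-integrable setT (EFin \o cst c0).
  exact: finite_measure_integrable_cst.
have z1 := integrableZl measurableT c1 i1.
have z2 := integrableZl measurableT c2 i2.
have z3 := integrableZl measurableT c3 i3.
have d1 := integrableD measurableT i0 z1.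
have d2 := integrableD measurableT d1 z2.
have d3 := integrableD measurableT d2 z3.
split; first exact: d3.
under eq_integral do rewrite !EFinD !EFinM.
rewrite (integralD measurableT d2 z3) (integralD measurableT d1 z2).
rewrite (integralD measurableT i0 z1) (integralZl measurableT i1).
rewrite (integralZl measurableT i2) (integralZl measurableT i3).
have -> : (\int[P]_w (EFin \o cst c0) w = c0%:E)%E.
  rewrite (_ : EFin \o cst c0 = cst c0%:E)//.
  by rewrite integral_cst//= probability_setT mule1.
by [].
Qed.

Definition capped_exp (R : realType) (b lambda s : R) : R :=
  expR (b * Num.min (s / lambda) 2).

Lemma measurable_capped_exp (R : realType) (b lambda : R) :
  measurable_fun [set: R] (capped_exp b lambda).
Proof.
apply: measurableT_comp => //; apply: measurable_funM => //.
apply: measurable_minr => //; exact: measurable_funM.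
Qed.

Lemma capped_exp_le (R : realType) (b lambda s : R) :
  0 <= b -> capped_exp b lambda s <= expR (2 * b).
Proof.
by move=> b0; rewrite ler_expR mulrC ler_wpM2r// ge_min lexx orbT.
Qed.

Lemma capped_exp_bounds (R : realType) (b lambda s : R) :
  0 <= b -> 0 < lambda -> `|s| <= lambda ->
  expR (- b) <= capped_exp b lambda s <= expR b.
Proof.
move=> b0 l0; rewrite ler_norml => /andP[s1 s2].
have h1 : -1 <= s / lambda by rewrite ler_pdivlMr// mulN1r.
have h2 : s / lambda <= 1 by rewrite ler_pdivrMr// mul1r.
rewrite /capped_exp min_l; last lra.
rewrite !ler_expR; apply/andP; split; nra.
Qed.

(** The linear term vanishes because X is centred.  The quadratic term gains
    b^2 sigma^2 / (4 lambda^2), and the last hypothesis on lambda says that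
    the cubic remainder costs at most half of it. *)
Lemma capped_exp_drift (R : realType) (d : measure_display)
    (T : measurableType d) (P : probability T R) (X : {RV P >-> R})
    (A sigma b lambda s : R) :
  ('E_P[X] = 0)%E -> ('E_P[fun w => (`|X w| ^+ 3)%R] <= A%:E)%E ->
  ((sigma ^+ 2)%:E <= 'E_P[fun w => (X w ^+ 2)%R])%E ->
  0 <= b -> 0 < lambda -> s <= lambda ->
  8 * (1 + b) ^+ 3 * A <= b ^+ 2 * sigma ^+ 2 * lambda ->
  (((1 + b ^+ 2 * sigma ^+ 2 / 8 / lambda ^+ 2) * capped_exp b lambda s)%:E
    <= \int[P]_w (capped_exp b lambda (s + X w))%:E)%E.
Proof.
move=> X1 X3 X2 b0 l0 sl hl.
have X3oo : ('E_P[fun w => (`|X w| ^+ 3)%R] < +oo)%E.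
  by rewrite (le_lt_trans X3)// ltry.
have [_ i2 _] := integrable_abs3 X3oo.
set f := capped_exp b lambda s.
have [iq Eq] := integral_cubic f (f * (b / lambda))
  (f * (b ^+ 2 / 4 / lambda ^+ 2)) (- (f * ((1 + b) ^+ 3 / lambda ^+ 3))) X3oo.
have f0 : 0 <= f by exact: expR_ge0.
have sl1 : s / lambda <= 1 by rewrite ler_pdivrMr// mul1r.
have fE : f = expR (b * (s / lambda)).
  by rewrite /f /capped_exp min_l//; lra.
have l0' : lambda != 0 by rewrite gt_eqF.
apply: (@le_trans _ _ (\int[P]_w
   (f + f * (b / lambda) * X w + f * (b ^+ 2 / 4 / lambda ^+ 2) * X w ^+ 2 +
    - (f * ((1 + b) ^+ 3 / lambda ^+ 3)) * `|X w| ^+ 3)%:E)%E); last first.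
  apply: le_integral => //.
    apply/integrableP; split.
      apply/measurable_EFinP.
      apply: (measurableT_comp (measurable_capped_exp _ _)).
      exact: measurable_funD.
    apply: (@le_lt_trans _ _ (\int[P]_w (cst (expR (b * 2))%:E w))%E).
      apply: ge0_le_integral => //.
      - apply/measurable_EFinP; apply: measurableT_comp => //.
        apply: (measurableT_comp (measurable_capped_exp _ _)).
        exact: measurable_funD.
      - move=> w _; rewrite lee_fin ger0_norm ?expR_ge0// ler_expR.
        by rewrite ler_wpM2l// ge_min lexx orbT.
    by rewrite integral_cst//= probability_setT mule1 ltry.
  move=> w _; rewrite lee_fin /capped_exp mulrDl.
  apply: le_trans (capped_expR_ge (X w / lambda) b0 sl1).
  rewrite -fE normrM normfV (gtr0_norm l0) le_eqVlt; apply/orP; left.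
  by apply/eqP; field.
rewrite Eq X1 mule0 adde0.
move: X2 X3 X3oo.
have : (0 <= 'E_P[fun w => (`|X w| ^+ 3)%R])%E.
  by apply: expectation_ge0 => w; rewrite exprn_ge0.
case: ('E_P[fun w => (`|X w| ^+ 3)%R])%E => [e3| |]// e30.
have fq : 0 <= f * (b ^+ 2 / 4 / lambda ^+ 2).
  by rewrite mulr_ge0// !mulr_ge0 ?invr_ge0 ?sqr_ge0.
have : ('E_P[fun w => (X w ^+ 2)%R])%E \is a fin_num.
  exact/expectation_fin_num/Lfun1_integrable.
case: ('E_P[fun w => (X w ^+ 2)%R])%E => [e2| |]// _.
rewrite !lee_fin => X2 X3 _.
  have h2 := ler_wpM2l fq X2.
  have h3 : f * ((1 + b) ^+ 3 / lambda ^+ 3) * e3 <=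
      f * ((1 + b) ^+ 3 / lambda ^+ 3) * A.
    by rewrite ler_wpM2l// mulr_ge0// mulr_ge0 ?invr_ge0 ?exprn_ge0//; lra.
  have h4 : f * ((1 + b) ^+ 3 / lambda ^+ 3) * A <=
     f * (b ^+ 2 / 8 / lambda ^+ 2) * sigma ^+ 2.
    have -> : f * ((1 + b) ^+ 3 / lambda ^+ 3) * A =
      f / (8 * lambda ^+ 3) * (8 * (1 + b) ^+ 3 * A) by field.
    have -> : f * (b ^+ 2 / 8 / lambda ^+ 2) * sigma ^+ 2 =
      f / (8 * lambda ^+ 3) * (b ^+ 2 * sigma ^+ 2 * lambda) by field.
    rewrite ler_wpM2l// mulr_ge0// invr_ge0 mulr_ge0// exprn_ge0//; lra.
  (* Half of the quadratic gain pays for the cubic remainder. *)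
  have -> : (1 + b ^+ 2 * sigma ^+ 2 / 8 / lambda ^+ 2) * f =
    f + f * (b ^+ 2 / 4 / lambda ^+ 2) * sigma ^+ 2 -
    f * (b ^+ 2 / 8 / lambda ^+ 2) * sigma ^+ 2 by field.
  lra.
Qed.

Lemma integral_between (R : realType) (d : measure_display)
    (T : measurableType d) (P : probability T R) (E : set T) (h : T -> R)
    (lo hi : R) :
  measurable E -> measurable_fun [set: T] h -> 0 <= lo ->
  (forall w, E w -> lo <= h w <= hi) ->
  (lo%:E * P E <= \int[P]_(w in E) (h w)%:E <= hi%:E * P E)%E.
Proof.
move=> mE mh lo0 hlohi.
have mhE : measurable_fun E (EFin \o h).
  exact/measurable_EFinP/measurable_funTS.
have h0 w : E w -> (0 <= (h w)%:E)%E.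
  by move=> /hlohi/andP[+ _]; rewrite lee_fin; exact: le_trans.
apply/andP; split.
  rewrite -integral_cst//; apply: ge0_le_integral => //.
  by move=> w /hlohi/andP[+ _]; rewrite lee_fin.
rewrite -integral_cst//; apply: ge0_le_integral => //.
by move=> w /hlohi/andP[_ +]; rewrite lee_fin.
Qed.

(** * The stopped walk *)

Section stopped_walk.
Context (R : realType) (d : measure_display) (T : measurableType d)
  (P : probability T R) (n : nat) (X : 'I_n -> {RV P >-> R}) (lambda : R).

Definition stopped_move (z : R * R) : R :=
  if `|z.1| <= lambda then z.1 + z.2 else z.1.

(** Freezing the walk at its first position outside [-lambda, lambda] makes
    the event that it has never left a function of its current value, so that
    one real variable carries both.  The value 0 of a step of index at least n
    is a default. *)
Fixpoint stopped_walk (k : nat) (w : T) : R :=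
  if k is k'.+1 then
    stopped_move (stopped_walk k' w, oapp (fun i => X i w) 0 (insub k'))
  else 0.

Lemma measurable_stopped_move : measurable_fun [set: R * R] stopped_move.
Proof.
apply: measurable_fun_ifT => //; last exact: measurable_funD.
by apply: measurable_fun_ler => //; exact: measurableT_comp.
Qed.

Lemma measurable_stopped_walk (k : nat) :
  measurable_fun [set: T] (stopped_walk k).
Proof.
elim: k => [|k IH] /=; first exact: measurable_cst.
apply: (measurableT_comp measurable_stopped_move).
apply: measurable_fun_pair => //.
by case: insub => [i|] /=; first exact: measurable_funP.
Qed.

HB.instance Definition _ (k : nat) :=
  isMeasurableFun.Build _ _ _ _ (stopped_walk k) (measurable_stopped_walk k).

Lemma stopped_walkS (i : 'I_n) (w : T) :
  stopped_walk i.+1 w = stopped_move (stopped_walk i w, X i w).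
Proof. by rewrite /= valK. Qed.

Lemma stopped_walk_walk (w : T) (k : nat) :
  (k <= n)%N -> 0 <= lambda ->
  (forall j, (0 < j <= k)%N -> `|walk X j w| <= lambda) ->
  stopped_walk k w = walk X k w.
Proof.
move=> kn l0; elim: k kn => [|k IH] kn small.
  by rewrite /= /walk big_pred0.
have Wk : stopped_walk k w = walk X k w.
  apply: IH => [|j /andP[j0 jk]]; first exact: ltnW.
  by rewrite small// j0 ltnW.
rewrite -[k in LHS]/(nat_of_ord (Ordinal kn)) stopped_walkS/= Wk.
rewrite /stopped_move/=.
rewrite ifT; last first.
  case: k kn small {IH Wk} => [|k] kn small; last by apply: small => /=.
  by rewrite /walk big_pred0// normr0.
rewrite /walk [RHS](bigD1 (Ordinal kn))//= addrC; congr (_ + _).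
by apply: eq_bigl => i; rewrite ltnS -val_eqE/= ltn_neqAle andbC.
Qed.

Definition cylinder (J : {set 'I_n}) (B : 'I_n -> set R) : set T :=
  [set w | forall i, i \in J -> B i (X i w)].

Lemma measurable_cylinder (J : {set 'I_n}) (B : 'I_n -> set R) :
  (forall i, i \in J -> measurable (B i)) -> measurable (cylinder J B).
Proof.
move=> mB.
have -> : cylinder J B = \bigcap_(i in [set` J]) (X i @^-1` B i) by [].
apply: fin_bigcap_measurable => // i iJ.
by rewrite -[_ @^-1` _]setTI; apply: measurable_funP => //; exact: mB.
Qed.

Lemma cylinder1 (i : 'I_n) (B : set R) :
  cylinder [set i]%SET (fun=> B) = X i @^-1` B.
Proof.
apply/seteqP; split => w /= h; first by apply: h; rewrite finset.inE.
by move=> j; rewrite finset.inE => /eqP ->.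
Qed.

(** The induction on k needs all the later steps at once: to move from k
    to k + 1, the condition on the step k is first added to the cylinder and
    then, by uniqueness of measures, absorbed into the position. *)
Lemma stopped_walk_indep_cylinder (k : nat) :
  mutually_independent X -> (k <= n)%N ->
  forall (J : {set 'I_n}) (B : 'I_n -> set R) (A : set R),
  (forall i, i \in J -> (k <= i)%N) ->
  (forall i, i \in J -> measurable (B i)) -> measurable A ->
  P (stopped_walk k @^-1` A `&` cylinder J B) =
  (P (stopped_walk k @^-1` A) * P (cylinder J B))%E.
Proof.
move=> indX; elim: k => [|k IH] kn J B A Jk mB mA.
  have [A0|A0] := pselect (A 0).
    rewrite (_ : _ @^-1` A = setT).
      by rewrite setTI probability_setT mul1e.
    by apply/seteqP; split.
  rewrite (_ : _ @^-1` A = set0); first by rewrite set0I measure0 mul0e.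
  by apply/seteqP; split.
pose i := Ordinal kn.
have {}IH := IH (ltnW kn).
have iJ : i \notin J by apply/negP => /Jk; rewrite /= ltnn.
have pair_indep (A' B' : set R) : measurable A' -> measurable B' ->
    P (stopped_walk k @^-1` A' `&` X i @^-1` B') =
    (P (stopped_walk k @^-1` A') * P (X i @^-1` B'))%E.
  move=> mA' mB'; rewrite -cylinder1 IH// => j.
  by rewrite finset.inE => /eqP ->.
(* The next position is a function of the current one and of the step i, so
   it suffices to treat this pair. *)
pose C := [set z | A (stopped_move z)].
have mC : measurable C.
  by rewrite -[C]setTI; exact: measurable_stopped_move.
rewrite (_ : _ @^-1` A = [set w | C (stopped_walk k w, X i w)]); last first.
  by apply/funext => w; congr A; exact: (stopped_walkS i w).
apply: rectangle_independence_ext => //; first exact: measurable_cylinder.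
move=> A' B' mA' mB'; rewrite pair_indep//.
(* On rectangles, the condition on the step i joins those of the cylinder. *)
pose B2 j := if j == i then B' else B j.
have cylE : X i @^-1` B' `&` cylinder J B = cylinder (i |: J)%SET B2.
  apply/seteqP; split => w /=.
    move=> [wB' wJ] j; rewrite finset.in_setU1 /B2.
    by case: eqP => [-> //|_ /= /wJ].
  move=> h; split => [|j jJ].
    by have := h i; rewrite finset.setU11 /B2 eqxx; apply.
  have := h j; rewrite finset.in_setU1 jJ orbT /B2.
  by case: eqP => [ji|_]; [rewrite -ji jJ in iJ|apply].
have mB2 j : j \in (i |: J)%SET -> measurable (B2 j).
  rewrite finset.in_setU1 /B2; by case: eqP => // _ /= /mB.
rewrite -setIA cylE IH//; last first.
  by move=> j; rewrite finset.in_setU1 => /orP[/eqP ->//|/Jk /ltnW].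
rewrite -muleA; congr (_ * _)%E.
rewrite /cylinder !indX// big_setU1//= {1}/B2 eqxx; congr (_ * _)%E.
apply: eq_bigr => j jJ; rewrite /B2; case: eqP => // ji.
by rewrite -ji jJ in iJ.
Qed.

Lemma stopped_walk_indep_step (i : 'I_n) (A B : set R) :
  mutually_independent X -> measurable A -> measurable B ->
  P (stopped_walk i @^-1` A `&` X i @^-1` B) =
  (P (stopped_walk i @^-1` A) * P (X i @^-1` B))%E.
Proof.
move=> indX mA mB; rewrite -cylinder1.
apply: stopped_walk_indep_cylinder => //; first exact: ltnW.
by move=> j; rewrite finset.inE => /eqP ->.
Qed.

(** * Survival probabilities *)

Definition survival (k : nat) : set T :=
  stopped_walk k @^-1` [set x | `|x| <= lambda].

Let measurable_interval : measurable [set x : R | `|x| <= lambda].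
Proof.
rewrite (_ : [set _ | _] = `[- lambda, lambda]%classic).
  exact: measurable_itv.
by apply/seteqP; split => x /=; rewrite in_itv/= ler_norml.
Qed.

Lemma measurable_survival (k : nat) : measurable (survival k).
Proof. by rewrite -[survival _]setTI; apply: measurable_funP. Qed.

Lemma survival_decr (k : nat) : survival k.+1 `<=` survival k.
Proof.
by move=> w; rewrite /survival/= /stopped_move/=; case: ifP => [//|->].
Qed.

Lemma max_abs_walk_survival : 0 <= lambda ->
  [set w | max_abs_walk X w <= lambda] `<=` survival n.
Proof.
move=> l0 w /= maxle.
have small j : (0 < j <= n)%N -> `|walk X j w| <= lambda.
  move=> /andP[j0 jn]; apply: le_trans maxle.
  rewrite /max_abs_walk.
  apply: (@Order.TotalTheory.bigmax_sup_seq _ _ _ _ _ j) => //.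
  by rewrite mem_index_iota j0.
rewrite /survival/= stopped_walk_walk//.
have [n0|n0] := posnP n; last by rewrite small// n0 leqnn.
rewrite /walk big1 ?normr0// => j _; exfalso.
by move: (leq_ltn_trans (leq0n j) (ltn_ord j)); rewrite n0.
Qed.

Lemma measurable_walk (k : nat) :
  measurable_fun [set: T] (walk X k).
Proof.
rewrite /walk; under eq_fun do rewrite big_mkcond.
by apply: measurable_sum => i; case: (i < k)%N.
Qed.

Lemma measurable_max_abs_walk : measurable_fun [set: T] (max_abs_walk X).
Proof.
rewrite /max_abs_walk; elim: (index_iota _ _) => [|k s IH].
  by under eq_fun do rewrite big_nil; exact: measurable_cst.
under eq_fun do rewrite big_cons.
apply: measurable_maxr => //; apply: measurableT_comp => //.
exact: measurable_walk.
Qed.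

Definition survival_prob (k : nat) : R := fine (P (survival k)).

Lemma max_abs_walk_le_survival_prob : 0 <= lambda ->
  (P [set w | (max_abs_walk X w <= lambda)%R] <= (survival_prob n)%:E)%E.
Proof.
move=> lambda_ge0; have mS := measurable_survival n.
rewrite /survival_prob fineK ?fin_num_measure//.
apply: le_measure; rewrite ?inE//; last exact: max_abs_walk_survival.
rewrite -[X in measurable X]setTI.
exact: (measurable_fun_ler measurable_max_abs_walk (measurable_cst lambda) _
  (Y := [set true])).
Qed.

Definition survival_weight (b : R) (k : nat) : R :=
  fine (\int[P]_(w in survival k)
          (capped_exp b lambda (stopped_walk k w))%:E).

(** The drift is applied to the walk that has survived up to time k.  The
    part of the integral carried by the walks that leave at the next step is
    bounded by the maximum exp(2b) of the test function times the lost
    mass. *)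
Lemma survival_recursion (A sigma b : R) :
  mutually_independent X ->
  (forall i, ('E_P[X i] = 0)%E) ->
  (forall i, ('E_P[(fun w => (`|X i w| ^+ 3)%R)] <= A%:E)%E) ->
  (forall i, ((sigma ^+ 2)%:E <= 'E_P[(fun w => (X i w ^+ 2)%R)])%E) ->
  0 <= b -> 0 < lambda ->
  8 * (1 + b) ^+ 3 * A <= b ^+ 2 * sigma ^+ 2 * lambda ->
  let p := survival_prob in
  let D := survival_weight b in
  [/\ forall k, 0 <= p k <= 1,
      forall k, p k.+1 <= p k,
      forall k, expR (- b) * p k <= D k <= expR b * p k &
      forall k, (k < n)%N ->
        (1 + b ^+ 2 * sigma ^+ 2 / 8 / lambda ^+ 2) * D k <=
        D k.+1 + expR (2 * b) * (p k - p k.+1)].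
Proof.
move=> indX EX EX3 EX2 b0 l0 hl p D.
have mS k := measurable_survival k.
have mf := measurable_capped_exp b lambda.
have mfW k : measurable_fun [set: T]
    (fun w => capped_exp b lambda (stopped_walk k w)).
  exact: measurableT_comp.
have pE k : P (survival k) = (p k)%:E.
  by rewrite fineK// fin_num_measure.
have Dbd k : ((expR (- b) * p k)%:E <=
    \int[P]_(w in survival k)
      (capped_exp b lambda (stopped_walk k w))%:E <=
    (expR b * p k)%:E)%E.
  rewrite !EFinM -pE; apply: integral_between => // w Sw.
  exact: capped_exp_bounds.
have DE k : (\int[P]_(w in survival k)
    (capped_exp b lambda (stopped_walk k w))%:E = (D k)%:E)%E.
  rewrite fineK//; have /andP[h1 h2] := Dbd k.
  rewrite fin_numE; apply/andP; split.
    by rewrite gt_eqF// (lt_le_trans _ h1)// ltNyr.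
  by rewrite lt_eqF// (le_lt_trans h2)// ltry.
split.
- move=> k; rewrite -!lee_fin -pE measure_ge0/= probability_le1//.
- move=> k; rewrite -lee_fin -!pE le_measure ?inE//.
  exact: survival_decr.
- by move=> k; rewrite -!lee_fin -DE.
move=> k kn.
pose i := Ordinal kn.
set r := 1 + _.
have r0 : 0 <= r.
  by rewrite addr_ge0// divr_ge0 ?sqr_ge0// divr_ge0// -exprMn sqr_ge0.
have drift x : `|x| <= lambda ->
    ((r * capped_exp b lambda x)%:E <=
     \int[P]_w (capped_exp b lambda (x + X i w))%:E)%E.
  move=> xl; apply: (capped_exp_drift (A := A)) => //.
  exact: le_trans (ler_norm x) xl.
have := independent_drift measurable_interval mf
  (fun x => expR_ge0 _) r0
  (fun B C => @stopped_walk_indep_step i B C indX) drift.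
rewrite -/(survival k) DE => h.
rewrite -lee_fin; apply: (le_trans h).
(* Split the survivors at time k according to survival at time k + 1. *)
set S1 := survival k.+1.
have SE : survival k = S1 `|` (survival k `\` S1).
  by rewrite setDUK//; exact: survival_decr.
rewrite {1}SE ge0_integral_setU//; last 5 first.
- exact: mS.
- exact: (measurableD (mS k) (mS k.+1)).
- apply/measurable_EFinP/measurable_funTS/measurableT_comp => //.
  exact: measurable_funD.
- by move=> w _; rewrite lee_fin expR_ge0.
- by rewrite disj_set2E setDIK.
rewrite EFinD leeD//.
  rewrite -DE le_eqVlt; apply/orP; left; apply/eqP.
  apply: eq_integral => w; rewrite inE => /survival_decr Sw.
  have -> : stopped_walk k.+1 w = stopped_move
     (stopped_walk k w, X i w) by exact: (stopped_walkS i w).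
  by rewrite /stopped_move/= ifT.
have -> : (expR (2 * b) * (p k - p k.+1))%:E =
   ((expR (2 * b))%:E * P (survival k `\` S1))%E.
  rewrite EFinM EFinB -!pE; congr (_ * _)%E; symmetry.
  rewrite -[X in (_ - P X)%E](setIidr (@survival_decr k)).
  apply: (measureD (mS k) (mS k.+1)).
  by rewrite -ge0_fin_numE// fin_num_measure.
have mXk : measurable_fun [set: T]
    (fun w => capped_exp b lambda (stopped_walk k w + X i w)).
  by apply: measurableT_comp => //; exact: measurable_funD.
have bounded w : 0 <= capped_exp b lambda (stopped_walk k w + X i w)
    <= expR (2 * b).
  by rewrite expR_ge0/= capped_exp_le.
by have /andP[] := @integral_between _ _ _ P _ _ 0 (expR (2 * b))
  (measurableD (mS k) (mS k.+1)) mXk (lexx 0) (fun w _ => bounded w).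
Qed.

End stopped_walk.

(** * Contraction over blocks *)

Lemma expR_le1D (R : realType) (x : R) :
  0 <= x -> x <= 1 -> expR (x / 2) <= 1 + x.
Proof.
move=> x0 x1.
have h : 1 - x / 2 <= (expR (x / 2))^-1.
  by rewrite -expRN; apply: le_trans (expR_ge1Dx _).
have e0 := expR_gt0 (x / 2).
have : (1 - x / 2) * expR (x / 2) <= 1.
  by rewrite -ler_pdivlMr// mul1r.
have : 0 <= (1 + x) * (1 - x / 2) - 1 by nra.
set e := expR _ in e0 *.
nra.
Qed.

(** Mass lost before time k + m enters at most with the full growth factor
    r ^+ m, because 1 <= r. *)
Lemma defect_recursion_iter (R : realType) (p D : nat -> R) (r M : R)
    (k m : nat) : 1 <= r -> 0 <= M ->
  (forall j, (j < m)%N -> p (k + j).+1 <= p (k + j)%N) ->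
  (forall j, (j < m)%N -> r * D (k + j)%N <=
     D (k + j).+1 + M * (p (k + j)%N - p (k + j).+1)) ->
  r ^+ m * (D k - M * (p k - p (k + m)%N)) <= D (k + m)%N.
Proof.
move=> r1 M0; elim: m => [|m IH] pdec Drec.
  by rewrite addn0 subrr mulr0 subr0 expr0 mul1r.
rewrite addnS; have {}IH := IH (fun j jm => pdec j (leqW jm))
  (fun j jm => Drec j (leqW jm)).
have h1 := Drec m (ltnSn m); have h2 := pdec m (ltnSn m).
have rm1 : 1 <= r ^+ m.+1 by rewrite exprn_ege1.
have r0 : 0 <= r by lra.
have := ler_wpM2l r0 IH.
rewrite mulrA -exprS.
set q := r ^+ m.+1 in rm1 *.
have : 0 <= (q - 1) * (M * (p (k + m)%N - p (k + m).+1)).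
  by rewrite mulr_ge0 ?mulr_ge0 ?subr_ge0.
nra.
Qed.

(** If little mass were lost, D would grow by a factor exp(4b), more than the
    factor exp(2b) by which D / p can vary; the excess measures the loss. *)
Lemma block_contraction (R : realType) (p D : nat -> R) (r b : R)
    (k m : nat) : 1 <= r -> 0 <= b -> expR (4 * b) <= r ^+ m ->
  0 <= p k ->
  (forall j, (j < m)%N -> p (k + j).+1 <= p (k + j)%N) ->
  (forall j, (j < m)%N -> r * D (k + j)%N <=
     D (k + j).+1 + expR (2 * b) * (p (k + j)%N - p (k + j).+1)) ->
  expR (- b) * p k <= D k -> D (k + m)%N <= expR b * p (k + m)%N ->
  p (k + m)%N <= (1 - expR (- (3 * b)) * (1 - expR (- (2 * b)))) * p k.
Proof.
move=> r1 b0 rm pk0 pdec Drec Dlo Dhi.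
have pm : p (k + m)%N <= p k.
  elim: m pdec {rm Drec Dhi} => [|m IH] pdec; first by rewrite addn0.
  rewrite addnS (le_trans (pdec m (ltnSn m)))// IH// => j jm.
  exact/pdec/leqW.
have := defect_recursion_iter r1 (expR_ge0 _) pdec Drec.
set y := D k - _ => hy.
have hq : y <= expR (- (3 * b)) * p k.
  have [y0|y0] := leP y 0; first by rewrite (le_trans y0)// mulr_ge0 ?expR_ge0.
  have : expR (4 * b) * y <= expR b * p k.
    rewrite (le_trans _ (_ : expR b * p (k + m)%N <= _))//; last first.
      by rewrite ler_wpM2l ?expR_ge0.
    apply: le_trans (le_trans hy Dhi).
    by rewrite ler_wpM2r// ltW.
  rewrite -ler_pdivlMl ?expR_gt0// -expRN mulrA -expRD.
  by have -> : - (4 * b) + b = - (3 * b) by ring.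
have h2 : expR (- (2 * b)) *
    (expR (- b) * p k - expR (2 * b) * (p k - p (k + m)%N)) <=
    expR (- (2 * b)) * (expR (- (3 * b)) * p k).
  rewrite ler_wpM2l ?expR_ge0// (le_trans _ hq)// /y lerD2r//.
have E1 : expR (- (2 * b)) * expR (- b) = expR (- (3 * b)).
  by rewrite -expRD; congr expR; ring.
have E2 : expR (- (2 * b)) * expR (2 * b) = 1 by rewrite -expRD addNr expR0.
move: h2; rewrite mulrBr !mulrA E1 E2.
lra.
Qed.

Lemma block_iteration (R : realType) (p : nat -> R) (q : R) (m n : nat) :
  0 <= q -> p 0%N <= 1 -> (forall k, p k.+1 <= p k) ->
  (forall k, (k + m <= n)%N -> p (k + m)%N <= q * p k) ->
  p n <= q ^+ (n %/ m).
Proof.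
move=> q0 p0 pdec pblock.
have pmono k j : p (k + j)%N <= p k.
  elim: j => [|j IH]; first by rewrite addn0.
  by rewrite addnS (le_trans (pdec _)).
have blocks j : (j * m <= n)%N -> p (j * m)%N <= q ^+ j.
  elim: j => [|j IH] jm; first by rewrite mul0n expr0.
  rewrite mulSn addnC (le_trans (pblock _ _)) ?exprS ?ler_wpM2l ?IH//.
    by rewrite addnC -mulSn.
  by rewrite (leq_trans _ jm)// leq_mul2r leqnSn orbT.
rewrite {1}(divn_eq n m) (le_trans (pmono _ _))// blocks//.
exact: leq_divM.
Qed.

Lemma natr_truncn_ge_half (R : realType) (x : R) :
  1 <= x -> x / 2 <= (Num.truncn x)%:R.
Proof.
move=> x_ge1; have x_ge0 : 0 <= x by lra.
have /andP[_ x_lt] := truncn_itv x_ge0.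
have : 1 <= (Num.truncn x)%:R :> R by rewrite ler1n truncn_gt0.
by rewrite -natr1 in x_lt; lra.
Qed.

(** For kappa / x at most 1, each factor is at least exp(kappa / (2x)), and
    there are at least x / 2 factors. *)
Lemma block_growth (R : realType) (kappa x : R) :
  0 <= kappa -> kappa <= x -> 1 <= x ->
  expR (kappa / 4) <= (1 + kappa / x) ^+ Num.truncn x.
Proof.
move=> kappa_ge0 kappa_le x_ge1; have x_gt0 : 0 < x by lra.
have q_ge0 : 0 <= kappa / x by rewrite divr_ge0// ltW.
have q_le1 : kappa / x <= 1 by rewrite ler_pdivrMr// mul1r.
apply: (@le_trans _ _ (expR (kappa / x / 2) ^+ Num.truncn x)).
  rewrite -expRM_natl ler_expR.
  have := ler_wpM2r q_ge0 (natr_truncn_ge_half x_ge1).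
  have -> : x / 2 * (kappa / x) = kappa / 2 by field; rewrite gt_eqF.
  lra.
by rewrite ler_pXn2r ?truncn_gt0 ?nnegrE ?expR_ge0 ?expR_le1D//; lra.
Qed.

(** As x <= n there is at least one complete block, so rounding the number of
    blocks down costs at most a factor 2. *)
Lemma expr_blocks_le_expR (R : realType) (delta x : R) (n : nat) :
  0 <= delta -> delta <= 1 -> 1 <= x -> x <= n%:R ->
  (1 - delta) ^+ (n %/ Num.truncn x) <= expR (- (delta / 2 * n%:R / x)).
Proof.
move=> delta_ge0 delta_le1 x_ge1 x_le.
have m_gt0 : (0 < Num.truncn x)%N by rewrite truncn_gt0.
have /andP[m_le _] : (Num.truncn x)%:R <= x < (Num.truncn x).+1%:R.
  by apply: truncn_itv; lra.
move: m_gt0 m_le; set m := Num.truncn x => m_gt0 m_le.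
have mn : (m <= n)%N by rewrite -(ler_nat R) (le_trans m_le).
have N_gt0 : (0 < n %/ m)%N by rewrite divn_gt0.
have n_le : n%:R <= (n %/ m).+1%:R * m%:R :> R.
  by rewrite -natrM ler_nat ltnW// ltn_ceil.
have N_le : (n %/ m).+1%:R <= 2 * (n %/ m)%:R :> R.
  by rewrite -natrM ler_nat mul2n -addnn -addn1 leq_add2l.
apply: (@le_trans _ _ (expR (- delta) ^+ (n %/ m))).
  rewrite ler_pXn2r ?nnegrE ?expR_ge0 ?subr_ge0//.
  exact: expR_ge1Dx.
rewrite -expRM_natl ler_expR mulrN lerN2 ler_pdivrMr; last lra.
have N_ge0 : 0 <= (n %/ m)%:R :> R by rewrite ler0n.
have h : n%:R <= 2 * (n %/ m)%:R * x.
  apply: (le_trans n_le); apply: (@le_trans _ _ (2 * (n %/ m)%:R * m%:R)).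
    by rewrite ler_wpM2r.
  by rewrite ler_wpM2l// mulr_ge0.
by have := ler_wpM2l delta_ge0 h; lra.
Qed.

(** * Exponential decay of the survival probability *)

Theorem lemma3p4 (R : realType) (A sigma : R) (A_gt0 : 0 < A)
    (sigma_gt0 : 0 < sigma) :
  exists (c lambda0 : R) (n0 : nat),
    [/\ 0 < c, 0 <= lambda0, (1 <= n0)%N &
      forall (n : nat), (n0 <= n)%N ->
      forall (d : measure_display) (T : measurableType d)
             (P : probability T R) (X : 'I_n -> {RV P >-> R}),
        mutually_independent X ->
        (forall i, ('E_P[X i] = 0)%E) ->
        (forall i, ('E_P[(fun w => (`|X i w| ^+ 3)%R)] <= A%:E)%E) ->
        (forall i, ((sigma ^+ 2)%:E <= 'E_P[(fun w => (X i w ^+ 2)%R)])%E) ->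
        forall lambda : R, lambda0 <= lambda -> lambda <= Num.sqrt n%:R ->
          (P [set w | (max_abs_walk X w <= lambda)%R] <=
             (expR (- (c * n%:R / lambda ^+ 2)))%:E)%E].
Proof.
pose b := 128 / sigma ^+ 2.
pose kappa := b ^+ 2 * sigma ^+ 2 / 8.
pose delta := expR (- (3 * b)) * (1 - expR (- (2 * b))).
pose err := 8 * (1 + b) ^+ 3 * A / (b ^+ 2 * sigma ^+ 2).
have b_gt0 : 0 < b by rewrite divr_gt0// exprn_gt0.
have bs_gt0 : 0 < b ^+ 2 * sigma ^+ 2 by rewrite mulr_gt0// exprn_gt0.
(* The value of b is chosen for this identity, which makes the lower bound
   exp(kappa / 4) for the growth over a block equal to exp(4b). *)
have kappaE : kappa = 16 * b.
  by rewrite /kappa /b; field; rewrite gt_eqF.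
have delta_gt0 : 0 < delta.
  by rewrite mulr_gt0 ?expR_gt0// subr_gt0 expR_lt1 oppr_lt0 mulr_gt0.
have delta_le1 : delta <= 1.
  have : expR (- (3 * b)) <= 1 by rewrite expR_le1 oppr_le0 mulr_ge0// ltW.
  have := expR_ge0 (- (3 * b)); have := expR_ge0 (- (2 * b)).
  rewrite /delta; nra.
have err_ge0 : 0 <= err.
  by rewrite divr_ge0 ?(ltW bs_gt0)// !mulr_ge0 ?exprn_ge0 ?(ltW A_gt0)//; lra.
(* lambda >= kappa and lambda >= 1 bound kappa / lambda ^+ 2 by 1, and
   lambda >= err is the smallness condition on the cubic remainder. *)
exists (delta / 2), (1 + kappa + err), 1%N.
split => //; [by rewrite divr_gt0| lra |].
move=> n _ d T P X indX EX EX3 EX2 lambda lambda_ge lambda_le.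
have lambda_ge1 : 1 <= lambda by lra.
have lambda_gt0 : 0 < lambda by lra.
have sq_ge1 : 1 <= lambda ^+ 2 by rewrite exprn_ege1.
have sq_le : lambda ^+ 2 <= n%:R.
  rewrite -[n%:R]sqr_sqrtr ?ler0n//.
  by rewrite ler_pXn2r ?nnegrE ?sqrtr_ge0 ?(ltW lambda_gt0).
have kappa_le : kappa <= lambda ^+ 2.
  by apply: (@le_trans _ _ lambda); [lra|rewrite expr2 ler_peMl//; lra].
have remainder_le : 8 * (1 + b) ^+ 3 * A <= b ^+ 2 * sigma ^+ 2 * lambda.
  by rewrite [leRHS]mulrC -ler_pdivrMr//; rewrite -/err; lra.
have [p01 p_decr D_bounds D_rec] :=
  survival_recursion indX EX EX3 EX2 (ltW b_gt0) lambda_gt0 remainder_le.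
apply: (le_trans (max_abs_walk_le_survival_prob X (ltW lambda_gt0))).
rewrite lee_fin.
apply: (le_trans _ (expr_blocks_le_expR (ltW delta_gt0) delta_le1 sq_ge1 _))
  => //.
have growth : expR (4 * b) <=
    (1 + kappa / lambda ^+ 2) ^+ Num.truncn (lambda ^+ 2).
  have -> : 4 * b = kappa / 4 by lra.
  by apply: block_growth => //; lra.
apply: block_iteration => //.
- by rewrite subr_ge0.
- by have /andP[] := p01 0%N.
move=> k k_le; apply: (block_contraction _ (ltW b_gt0) growth) => //.
- by rewrite lerDl divr_ge0//; lra.
- by have /andP[] := p01 k.
- by move=> j jm; apply: D_rec; apply: leq_trans k_le; rewrite ltn_add2l.
- by have /andP[] := D_bounds k.
- by have /andP[] := D_bounds (k + Num.truncn (lambda ^+ 2))%N.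
Qed.
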